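(* Let $I$ be a countable set (finite or countably infinite), let $J$ be a set, let $V = (V(i))_{i \in I}$ and $W = (W(j))_{j \in J}$ be families of non-Archimedean Banach Abelian groups, and let $f \colon \prod V \to \bigoplus W$ be a non-zero bounded group homomorphism from the bounded direct product of $V$ to the completed direct sum of $W$. Then for any real number $r > 0$ there exist a real number $r' > \|f\|^{-1} r$, a finite subset $I_0 \subset I$, and a finite subset $J_0 \subset J$ such that $$f\left[ \prod^{I_0,r'} V \right] \subset \bigoplus^{J_0,r} W.$$
   Context: A (non-Archimedean) normed Abelian group is an Abelian group $A$ with a map $\|\cdot\| \colon A \to \mathbb{R}_{\geq 0}$ such that $\|a - b\| \leq \max\{\|a\|,\|b\|\}$ for all $a,b \in A$, and $\|a\| = 0$ if and only if $a = 0$. It is a Banach Abelian group if the ultrametric $(a,b) \mapsto \|a-b\|$ is complete. A group homomorphism $f \colon A \to B$ between Banach Abelian groups is bounded if there is $C \in \mathbb{R}_{\geq 0}$ with $\|f(a)\| \leq C\|a\|$ for all $a \in A$; the operator norm $\|f\|$ is the infimum of such $C$. For a set $I$ and a family $V = (V(i))_{i \in I}$ of Banach Abelian groups, the bounded direct product $\prod V$ is the Banach Abelian group of all families $x = (x(i))_{i \in I}$ with $x(i) \in V(i)$ and $\sup_{i \in I}\|x(i)\| < \infty$, with norm $\|x\| = \sup_{i \in I}\|x(i)\|$ (the supremum over the empty set being $0$). The completed direct sum $\bigoplus V$ is the closed subgroup of those $x \in \prod V$ such that for every real $\epsilon > 0$ the set $\{i \in I : \|x(i)\| > \epsilon\}$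 is finite. For $I_0 \subset I$ and $r \in \mathbb{R}_{\geq 0}$ put $$\prod^{I_0,r} V := \{x \in \prod V : x(i) = 0 \text{ for all } i \in I_0, \text{ and } \|x(i)\| \leq r \text{ for all } i \in I\},$$ $$\bigoplus^{I_0,r} V := \{x \in \bigoplus V : \|x(i)\| \leq r \text{ for all } i \in I \setminus I_0\},$$ and use the same notation for the family $W$ indexed by $J$. $f[X]$ denotes the image of the subset $X$ under $f$. *)

(* Defs.v *)
From HB Require Import structures.
From mathcomp Require Import all_boot all_order all_algebra.
From mathcomp Require Import all_classical all_reals all_analysis.

Set Implicit Arguments.
Unset Strict Implicit.
Unset Printing Implicit Defensive.

Import Order.TTheory GRing.Theory Num.Theory.

Local Open Scope classical_set_scope.
Local Open Scope ring_scope.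

(* Num.NormedZmodule cannot be used for these groups: it requires
   `|x *+ n| = `|x| *+ n, which fails for non-Archimedean norms. *)
HB.mixin Record Zmodule_isUltranormed (R : realType) A & GRing.Zmodule A := {
  unorm : A -> R ;
  unorm_ge0 : forall a, 0 <= unorm a ;
  unormB_le_max : forall a b, unorm (a - b) <= Num.max (unorm a) (unorm b) ;
  unorm_eq0P : forall a, unorm a = 0 <-> a = 0
}.

#[short(type="ultranormedZmodType")]
HB.structure Definition UltranormedZmod (R : realType) :=
  {A of GRing.Zmodule A & Zmodule_isUltranormed R A}.

Arguments unorm {R s} a : rename.

Section ultranormed_theory.
Context {R : realType} {A : ultranormedZmodType R}.
Implicit Types a b c : A.

Lemma unorm0 : unorm (0 : A) = 0. Proof. exact/unorm_eq0P. Qed.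

Lemma unormN a : unorm (- a) = unorm a.
Proof.
have le b : unorm (- b) <= unorm b.
  by rewrite -sub0r (le_trans (unormB_le_max _ _))// unorm0 ge_max unorm_ge0/=.
by apply/eqP; rewrite eq_le le/= -{1}(opprK a) le.
Qed.

Lemma unormD_le_max a b : unorm (a + b) <= Num.max (unorm a) (unorm b).
Proof. by rewrite -{1}(opprK b) (le_trans (unormB_le_max _ _))// unormN. Qed.

Lemma unorm_distC a b : unorm (a - b) = unorm (b - a).
Proof. by rewrite -unormN opprB. Qed.

End ultranormed_theory.

(* An alias carrying the metric space structure. A structure extending both
   Zmodule and Metric cannot be declared on A itself: HB requires it to come
   before PseudoMetricNormedZmod in the hierarchy. *)
Definition ultrametric {R : realType} (A : ultranormedZmodType R) : Type := A.

Section ultrametric_space.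
Context {R : realType} {A : ultranormedZmodType R}.

Definition udist (a b : A) : R := unorm (a - b).

Lemma udistxx a : udist a a = 0.
Proof. by rewrite /udist subrr unorm0. Qed.

Lemma udist_eq0 a b : udist a b = 0 -> a = b.
Proof. by move/unorm_eq0P/eqP; rewrite subr_eq0 => /eqP. Qed.

Lemma udist_sym a b : udist a b = udist b a.
Proof. exact: unorm_distC. Qed.

Lemma udist_triangle b a c : udist a c <= udist a b + udist b c.
Proof.
rewrite /udist -(subrKA b) (le_trans (unormD_le_max _ _))// ge_max.
by rewrite lerDl lerDr !unorm_ge0.
Qed.

HB.instance Definition _ := Choice.copy (ultrametric A) A.
HB.instance Definition _ := isMetric.Build R (ultrametric A)
  udistxx udist_eq0 udist_sym udist_triangle.
HB.instance Definition _ := isPointed.Build (ultrametric A) (0 : A).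

Lemma ball_unormE (a : ultrametric A) (e : R) :
  ball a e = [set b | unorm ((a : A) - b) < e].
Proof. by rewrite ballEmdist. Qed.

End ultrametric_space.

HB.mixin Record Ultranormed_isComplete (R : realType) A
    & UltranormedZmod R A := {
  ultrametric_complete : forall F : set_system (ultrametric A),
    ProperFilter F -> cauchy F -> cvg F
}.

#[short(type="banachZmodType")]
HB.structure Definition BanachZmod (R : realType) :=
  {A of UltranormedZmod R A & Ultranormed_isComplete R A}.

HB.instance Definition _ (R : realType) (A : banachZmodType R) :=
  Uniform_isComplete.Build (ultrametric A) ultrametric_complete.

Section operator_norm.
Context {R : realType} {A B : ultranormedZmodType R}.

Definition operator_bounds (f : A -> B) : set R :=
  [set C | 0 <= C /\ forall a, unorm (f a) <= C * unorm a].

Definition bounded_hom (f : A -> B) : Prop := operator_bounds f !=set0.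

Definition opnorm (f : A -> B) : R := inf (operator_bounds f).

End operator_norm.

Section bounded_product.
Context {R : realType} {I : Type}.

Definition bounded_family (V : I -> banachZmodType R) (x : forall i, V i) :=
  has_ubound (range (fun i => unorm (x i))).

Record bprod (V : I -> banachZmodType R) := Bprod {
  bprod_fun :> forall i, V i ;
  bprodP : bounded_family bprod_fun }.

Variable V : I -> banachZmodType R.
Implicit Types x y z : bprod V.

HB.instance Definition _ := gen_eqMixin (bprod V).
HB.instance Definition _ := gen_choiceMixin (bprod V).

Lemma bprod_eq x y : (forall i, x i = y i) -> x = y.
Proof.
case: x y => [x bx] [y by_] /= xy.
have {xy} xy : x = y by exact: functional_extensionality_dep.
by case: y / xy by_ => b; congr Bprod; exact: Prop_irrelevance.
Qed.

Lemma bprod_boundP (x : forall i, V i) :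
  bounded_family x <-> exists M, 0 <= M /\ forall i, unorm (x i) <= M.
Proof.
split=> [[M Mx]|[M [_ Mx]]]; last by exists M => _ [i _ <-]; exact: Mx.
exists (Num.max 0 M); split; first by rewrite le_max lexx.
by move=> i; rewrite le_max (Mx (unorm (x i))) ?orbT//; exists i.
Qed.

Lemma bprod_zero_subproof : bounded_family (fun i => 0 : V i).
Proof. by apply/bprod_boundP; exists 0; split=> // i; rewrite unorm0. Qed.

Lemma bprod_opp_subproof x : bounded_family (fun i => - x i).
Proof.
have [M [M0 Mx]] := (bprod_boundP _).1 (bprodP x).
by apply/bprod_boundP; exists M; split=> // i; rewrite unormN.
Qed.

Lemma bprod_add_subproof x y : bounded_family (fun i => x i + y i).
Proof.
have [M [M0 Mx]] := (bprod_boundP _).1 (bprodP x).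
have [N [N0 Ny]] := (bprod_boundP _).1 (bprodP y).
apply/bprod_boundP; exists (Num.max M N); split; first by rewrite le_max M0.
move=> i; rewrite (le_trans (unormD_le_max _ _))// ge_max !le_max.
by rewrite Mx Ny orbT.
Qed.

Definition bprod_zero := Bprod bprod_zero_subproof.
Definition bprod_opp x := Bprod (bprod_opp_subproof x).
Definition bprod_add x y := Bprod (bprod_add_subproof x y).

Lemma bprod_addA : associative bprod_add.
Proof. by move=> x y z; apply: bprod_eq => i /=; rewrite addrA. Qed.
Lemma bprod_addC : commutative bprod_add.
Proof. by move=> x y; apply: bprod_eq => i /=; rewrite addrC. Qed.
Lemma bprod_add0 : left_id bprod_zero bprod_add.
Proof. by move=> x; apply: bprod_eq => i /=; rewrite add0r. Qed.
Lemma bprod_addN : left_inverse bprod_zero bprod_opp bprod_add.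
Proof. by move=> x; apply: bprod_eq => i /=; rewrite addNr. Qed.

HB.instance Definition _ := GRing.isZmodule.Build (bprod V)
  bprod_addA bprod_addC bprod_add0 bprod_addN.

Lemma bprod0E i : (0 : bprod V) i = 0. Proof. by []. Qed.
Lemma bprodNE x i : (- x) i = - x i. Proof. by []. Qed.
Lemma bprodDE x y i : (x + y) i = x i + y i. Proof. by []. Qed.
Lemma bprodBE x y i : (x - y) i = x i - y i. Proof. by []. Qed.

(* For empty I this is sup set0 = 0. *)
Definition bprod_norm x : R := sup (range (fun i => unorm (x i))).

Lemma bprod_norm_ub x i : unorm (x i) <= bprod_norm x.
Proof. by apply: ub_le_sup; [exact: bprodP | exists i]. Qed.

Lemma bprod_norm_le x (M : R) :
  0 <= M -> (bprod_norm x <= M <-> forall i, unorm (x i) <= M).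
Proof.
move=> M0; split=> [xM i|xM]; first exact: le_trans (bprod_norm_ub x i) xM.
have [ne|/set0P/negP/negPn/eqP e0] :=
    pselect (range (fun i => unorm (x i)) !=set0).
  by apply: ge_sup => // _ [i _ <-]; exact: xM.
by rewrite /bprod_norm e0 sup0.
Qed.

Lemma bprod_norm_ge0 x : 0 <= bprod_norm x.
Proof.
have [[_ [i _ _]]|/set0P/negP/negPn/eqP e0] :=
    pselect (range (fun i => unorm (x i)) !=set0).
  exact: le_trans (unorm_ge0 _) (bprod_norm_ub x i).
by rewrite /bprod_norm e0 sup0.
Qed.

Lemma bprod_normB x y :
  bprod_norm (x - y) <= Num.max (bprod_norm x) (bprod_norm y).
Proof.
apply/bprod_norm_le; first by rewrite le_max bprod_norm_ge0.
move=> i; rewrite bprodBE (le_trans (unormB_le_max _ _))// ge_max !le_max.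
by rewrite !bprod_norm_ub orbT.
Qed.

Lemma bprod_norm_eq0 x : bprod_norm x = 0 <-> x = 0.
Proof.
split=> [x0|->]; last first.
  apply/eqP; rewrite eq_le bprod_norm_ge0 andbT.
  by apply/bprod_norm_le => // i; rewrite bprod0E unorm0.
apply: bprod_eq => i; apply/unorm_eq0P/eqP.
by rewrite eq_le unorm_ge0 -x0 bprod_norm_ub.
Qed.

HB.instance Definition _ := Zmodule_isUltranormed.Build R (bprod V)
  bprod_norm_ge0 bprod_normB bprod_norm_eq0.

Lemma bprod_unormE x : unorm x = sup (range (fun i => unorm (x i))).
Proof. by []. Qed.

Lemma bprod_dist_le x y i : unorm (x i - y i) <= unorm (x - y).
Proof. exact: (bprod_norm_ub (x - y) i). Qed.

Lemma bprod_complete (F : set_system (ultrametric (bprod V))) :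
  ProperFilter F -> cauchy F -> cvg F.
Proof.
move=> FF Fc.
have Fex (e : R) : 0 < e -> exists x : ultrametric (bprod V), F (ball x e).
  by apply: (cauchyP F).1.
have cvgi i : cvg ((fun x : bprod V => x i : ultrametric (V i)) @ F).
  apply: cauchy_cvg; apply/cauchy_exP => e e0.
  have [x Fx] := Fex _ e0; exists ((x : bprod V) i).
  apply: (filterS _ Fx : F ((fun y : bprod V => y i) @^-1` _)) => y; rewrite !ball_unormE /=.
  exact: (le_lt_trans (bprod_dist_le x y i)).
pose l i := lim ((fun x : bprod V => x i : ultrametric (V i)) @ F).
have near_l (x : ultrametric (bprod V)) (e : R) : 0 < e -> F (ball x e) ->
    forall i, unorm ((x : bprod V) i - l i) < e.
  move=> e0 Fx i.
  have Fl : F [set y : bprod V | ball (l i : ultrametric (V i)) e (y i)].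
    by have := cvgi i; move=> /cvg_ballP/(_ _ e0).
  have [y []] := filter_ex (filterI Fx Fl).
  rewrite !ball_unormE /= => xy ly.
  rewrite -(subrKA (y i)) (le_lt_trans (unormD_le_max _ _))//.
  rewrite gt_max (unorm_distC (y i)) ly andbT.
  exact: le_lt_trans (bprod_dist_le x y i) xy.
have bl : bounded_family l.
  have [x Fx] := Fex _ ltr01.
  have [M [M0 Mx]] := (bprod_boundP _).1 (bprodP x).
  apply/bprod_boundP; exists (Num.max M 1); split; first by rewrite le_max M0.
  move=> i; rewrite -(subKr (x i) (l i)) (le_trans (unormB_le_max _ _))//.
  by rewrite ge_max !le_max Mx (ltW (near_l _ _ ltr01 Fx i)) orbT.
apply/cvg_ex; exists (Bprod bl : ultrametric (bprod V)); apply/cvg_ballP => e e0.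
have e20 : 0 < e / 2 by rewrite divr_gt0.
have [x Fx] := Fex _ e20; apply: filterS (Fx) => y.
rewrite !ball_unormE /= => xy.
suff : unorm (Bprod bl - y) <= e / 2.
  by move=> /le_lt_trans; apply; rewrite ltr_pdivrMr// ltr_pMr// ltr1n.
apply/bprod_norm_le; first exact: ltW.
move=> i /=; rewrite -(subrKA (x i)) (le_trans (unormD_le_max _ _))//.
rewrite ge_max unorm_distC (ltW (near_l _ _ e20 Fx i))/=.
exact: le_trans (bprod_dist_le x y i) (ltW xy).
Qed.

HB.instance Definition _ := Ultranormed_isComplete.Build R (bprod V) bprod_complete.

End bounded_product.

Section completed_sum.
Context {R : realType} {I : Type}.

Definition vanishing (V : I -> banachZmodType R) : {pred bprod V} :=
  [pred x : bprod V | `[< forall e : R, 0 < e ->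
     finite_set [set i | e < unorm (x i)] >]].

Record csum (V : I -> banachZmodType R) := Csum {
  csum_val :> bprod V ;
  csumP : csum_val \in @vanishing V }.

Variable V : I -> banachZmodType R.

HB.instance Definition _ := [isSub of csum V for @csum_val V].
HB.instance Definition _ := [Choice of csum V by <:].

Lemma vanishingP (x : bprod V) :
  reflect (forall e : R, 0 < e -> finite_set [set i | e < unorm (x i)])
          (x \in @vanishing V).
Proof. exact: asboolP. Qed.

Lemma vanishing_zmod_closed : zmod_closed (@vanishing V).
Proof.
split=> [|x y].
  apply/vanishingP => e e0; rewrite (_ : [set _ | _] = set0)//.
  by apply/seteqP; split=> // i /=; rewrite unorm0 ltNge ltW.
move=> /vanishingP vx /vanishingP vy; apply/vanishingP => e e0.
have: finite_set ([set i | e < unorm (x i)] `|` [set i | e < unorm (y i)]).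
  by rewrite finite_setU; split; [exact: vx | exact: vy].
apply: sub_finite_set => i /= exy.
by have := lt_le_trans exy (unormB_le_max _ _); rewrite lt_max => /orP.
Qed.

HB.instance Definition _ :=
  GRing.isZmodClosed.Build (bprod V) (@vanishing V) vanishing_zmod_closed.
HB.instance Definition _ := [SubChoice_isSubZmodule of csum V by <:].

Definition csum_norm (x : csum V) : R := unorm (csum_val x).

Lemma csum_norm_ge0 x : 0 <= csum_norm x. Proof. exact: unorm_ge0. Qed.

Lemma csum_normB x y :
  csum_norm (x - y) <= Num.max (csum_norm x) (csum_norm y).
Proof. exact: unormB_le_max. Qed.

Lemma csum_norm_eq0 x : csum_norm x = 0 <-> x = 0.
Proof.
split=> [/unorm_eq0P x0|->]; first exact/val_inj.
exact/unorm_eq0P.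
Qed.

HB.instance Definition _ := Zmodule_isUltranormed.Build R (csum V)
  csum_norm_ge0 csum_normB csum_norm_eq0.

Lemma csum_unormE (x : csum V) : unorm x = unorm (csum_val x).
Proof. by []. Qed.

Lemma csum_complete (F : set_system (ultrametric (csum V))) :
  ProperFilter F -> cauchy F -> cvg F.
Proof.
move=> FF Fc.
have /cvg_ex[l Fl] : cvg ((fun x : csum V => csum_val x : ultrametric (bprod V)) @ F).
  apply: cauchy_cvg; apply/cauchy_exP => e e0.
  have [x Fx] := (cauchyP F).1 Fc _ e0; exists (csum_val x : bprod V).
  by apply: (filterS _ Fx : F (@csum_val V @^-1` _)) => y; rewrite !ball_unormE.
have vl : l \in @vanishing V.
  apply/vanishingP => e e0.
  have [x] : exists x : csum V, ball (l : ultrametric (bprod V)) e (csum_val x).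
    exact: (filter_ex (cvg_ball Fl e0)).
  rewrite ball_unormE /= => lx.
  have /vanishingP/(_ _ e0) := csumP x.
  apply: sub_finite_set => i /= el.
  have := lt_le_trans el (_ : _ <= Num.max (unorm (l i - x i)) (unorm (x i))).
  rewrite -{1}(subrK (x i) (l i)) unormD_le_max lt_max => /(_ isT)/orP[|//].
  move=> /lt_trans/(_ (le_lt_trans (bprod_dist_le l x i) lx)).
  by rewrite ltxx.
apply/cvg_ex; exists (Csum vl : ultrametric (csum V)); apply/cvg_ballP => e e0.
apply: (filterS _ (cvg_ball Fl e0 : F _)) => y.
by rewrite !ball_unormE.
Qed.

HB.instance Definition _ := Ultranormed_isComplete.Build R (csum V) csum_complete.

End completed_sum.

Definition bprod_tail {R : realType} {I : Type} (V : I -> banachZmodType R)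
    (I0 : set I) (r : R) : set (bprod V) :=
  [set x | (forall i, I0 i -> x i = 0) /\ (forall i, unorm (x i) <= r)].

(* Unlike in bprod_tail, coordinates in J0 are unconstrained. *)
Definition csum_tail {R : realType} {J : Type} (W : J -> banachZmodType R)
    (J0 : set J) (r : R) : set (csum W) :=
  [set y | forall j, ~ J0 j -> unorm (y j) <= r].

Arguments bprod_tail {R I} V I0 r.
Arguments csum_tail {R J} W J0 r.

(* Main.v *)
Require Import Defs.
From HB Require Import structures.
From mathcomp Require Import all_boot all_order all_algebra.
From mathcomp Require Import all_classical all_reals all_analysis.

Set Implicit Arguments.
Unset Strict Implicit.
Unset Printing Implicit Defensive.

Import Order.TTheory GRing.Theory Num.Theory.

Local Open Scope classical_set_scope.
Local Open Scope ring_scope.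

(** The proof is a gliding hump argument.  Put [C := opnorm f] and
    [rho := C^-1 * r], and suppose that the conclusion fails for every
    [r' > rho].  Then one can choose inductively radii [s n > rho], vectors
    [x n] of norm at most [s n] vanishing at the first [n] indices of an
    enumeration of [I], and coordinates [j n] with [r < unorm (f (x n) (j n))],
    where [j n] avoids the finitely many coordinates at which some earlier
    [f (x k)] exceeds [r] ([escaping_sequence]).

    Because the inequality at [j n] is strict, there is room between [rho] and
    [C^-1 * unorm (f (x n) (j n))], and [s n.+1] is taken there.  This choice is
    the heart of the matter: the later vectors all have norm at most [s n.+1],
    so that their total contribution to the coordinate [j n] has norm at most
    [C * s n.+1], less than that of [f (x n)].

    Each index of [I] meets only finitely many of the [x n], so they have a
    pointwise sum [S], bounded since the norm is non-Archimedean
    ([locally_finite_sum]).  At the coordinate [j n], the earlier vectors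
    contribute at most [r] to [f S] and the later ones less than
    [f (x n)], so [f S] has norm greater than [r] there ([gliding_hump]).  The
    [j n] being distinct, this contradicts that [f S] lies in the completed
    direct sum. *)

Section ultranorm.
Context {R : realType} {A : ultranormedZmodType R}.

Lemma unorm_sum_le (K : Type) (l : seq K) (P : pred K) (F : K -> A) (M : R) :
  0 <= M -> (forall k, P k -> unorm (F k) <= M) ->
  unorm (\sum_(k <- l | P k) F k) <= M.
Proof.
move=> M0 FM; elim/big_ind: _ => // [|a b aM bM]; first by rewrite unorm0.
by rewrite (le_trans (unormD_le_max _ _))// ge_max aM.
Qed.

Lemma unormD_dominant (a b : A) : unorm b < unorm a -> unorm (a + b) = unorm a.
Proof.
move=> ba; apply/eqP; rewrite eq_le (le_trans (unormD_le_max _ _))/=; last first.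
  by rewrite ge_max lexx ltW.
have := unormB_le_max (a + b) b.
by rewrite addrK le_max => /orP[//|]; rewrite leNgt ba.
Qed.

End ultranorm.

Section opnorm.
Context {R : realType} {A B : ultranormedZmodType R} (f : {additive A -> B}).
Hypothesis f_bounded : bounded_hom f.

Lemma opnorm_le a : unorm (f a) <= opnorm f * unorm a.
Proof.
have [->|a0] := eqVneq a 0; first by rewrite raddf0 !unorm0 mulr0.
have ua : 0 < unorm a.
  rewrite lt_neqAle unorm_ge0 andbT eq_sym.
  by apply: contra_neq a0 => /unorm_eq0P.
rewrite -ler_pdivrMr//; apply: lb_le_inf => // C [_ Cf].
by rewrite ler_pdivrMr.
Qed.

Lemma opnorm_gt0 : (exists a, f a != 0) -> 0 < opnorm f.
Proof.
move=> [a fa0]; rewrite ltNge; apply: contra_neqN fa0 => C0.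
apply/unorm_eq0P/eqP; rewrite eq_le unorm_ge0 andbT.
by rewrite (le_trans (opnorm_le a))// mulr_le0_ge0// unorm_ge0.
Qed.

End opnorm.

(** The witness [S n] is the tail starting at [n] of the coordinatewise sum of
    [x]. At each coordinate the sum is finite, and the ultrametric inequality
    bounds it independently of the number of terms. *)
Lemma locally_finite_sum (R : realType) (I : Type) (V : I -> banachZmodType R)
    (g : I -> nat) (x : nat -> bprod V) (s : nat -> R) :
  (forall k i, (g i < k)%N -> x k i = 0) ->
  (forall k, unorm (x k) <= s k) -> (forall k, s k.+1 <= s k) ->
  exists S : nat -> bprod V,
    (forall n, S n = x n + S n.+1) /\ (forall n, unorm (S n) <= s n).
Proof.
move=> gx xs s_anti.
have s0 n : 0 <= s n := le_trans (unorm_ge0 _) (xs n).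
have s_le : nonincreasing_seq s by apply/nonincreasing_seqP.
pose t n i := \sum_(n <= k < (g i).+1) x k i.
have t_le n i : unorm (t n i) <= s n.
  rewrite /t big_nat; apply: unorm_sum_le => // k /andP[nk _].
  exact: le_trans (le_trans (bprod_norm_ub _ _) (xs k)) (s_le _ _ nk).
have t_bounded n : bounded_family (t n).
  by apply/bprod_boundP; exists (s n).
exists (fun n => Bprod (t_bounded n)); split=> n; last first.
  by apply/bprod_norm_le => // i; exact: t_le.
apply: bprod_eq => i; rewrite bprodDE /= /t.
have [ng|gn] := ltnP n (g i).+1; first by rewrite big_ltn.
by rewrite !big_geq ?(leqW gn)// gx// addr0.
Qed.

Section gliding_hump.
Context {R : realType} {I J : Type}.
Context {V : I -> banachZmodType R} {W : J -> banachZmodType R}.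
Variables (f : {additive bprod V -> csum W}) (C r : R).

Let f_coordD a b j : f (a + b) j = f a j + f b j.
Proof. by rewrite raddfD. Qed.

(** For each [n], the summand [x n] decides the size of the [j n]-th coordinate
    of [f (S 0)]: it beats the sum of the earlier [x k], of size at most [r],
    and the remaining tail [S n.+1], of size at most [C * s n.+1]. *)
Lemma gliding_hump (x S : nat -> bprod V) (j : nat -> J) (s : nat -> R) :
  0 <= C -> (forall a, unorm (f a) <= C * unorm a) -> 0 < r ->
  (forall n, S n = x n + S n.+1) -> (forall n, unorm (S n) <= s n) ->
  (forall n, r < unorm (f (x n) (j n))) ->
  (forall n, C * s n.+1 < unorm (f (x n) (j n))) ->
  (forall k n, (k < n)%N -> unorm (f (x k) (j n)) <= r) ->
  False.
Proof.
move=> C0 fC r0 Sx Ss xr xC early.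
have S0E n : S 0%N = \sum_(k < n) x k + S n.
  by elim: n => [|n IHn]; rewrite ?big_ord0 ?add0r// big_ord_recr/= -addrA -Sx.
have early_sum n m : (m <= n)%N -> unorm (f (\sum_(k < m) x k) (j n)) <= r.
  elim: m => [|m IHm] mn; first by rewrite big_ord0 raddf0 unorm0 ltW.
  rewrite big_ord_recr/= f_coordD (le_trans (unormD_le_max _ _))//.
  by rewrite ge_max IHm ?(ltnW mn)// early.
have big n : r < unorm (f (S 0%N) (j n)).
  have late : unorm (f (S n.+1) (j n)) < unorm (f (x n) (j n)).
    apply: le_lt_trans (xC n); apply: le_trans (bprod_norm_ub _ _) _.
    by apply: le_trans (fC _) _; apply: ler_wpM2l.
  have hump : unorm (f (S n) (j n)) = unorm (f (x n) (j n)).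
    by rewrite Sx f_coordD unormD_dominant.
  rewrite (S0E n) f_coordD addrC unormD_dominant hump ?xr//.
  exact: le_lt_trans (early_sum _ _ _) (xr n).
have j_neq k n : (k < n)%N -> j k <> j n.
  by move=> /early kn e; have := xr k; rewrite e ltNge kn.
have j_inj : injective j.
  by move=> k n jkn; case: (ltngtP k n) => // /j_neq; rewrite jkn.
have /vanishingP/(_ r r0) Jfin := csumP (f (S 0%N)).
apply: infinite_nat; apply: sub_finite_set (finite_preimage _ Jfin) => [n _|].
  exact: big.
by move=> k n _ _; exact: j_inj.
Qed.

(** A radius [s n.+1 > rho] with [C * s n.+1 < unorm (f (x n) (j n))] exists
    because [C * rho = r] lies strictly below that norm; being above [rho], it
    allows the next vector to be chosen within it. *)
Lemma escaping_sequence (rho : R) (g : I -> nat) :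
  0 < C -> rho = C^-1 * r -> injective g ->
  (forall s I0 J0, rho < s -> finite_set I0 -> finite_set J0 ->
     exists (x : bprod V) (j : J),
       [/\ bprod_tail V I0 s x, ~ J0 j & r < unorm (f x j)]) ->
  0 < r ->
  exists (x : nat -> bprod V) (j : nat -> J) (s : nat -> R),
    [/\ forall n, bprod_tail V [set i | (g i < n)%N] (s n) (x n),
        forall n, rho < s n /\ s n.+1 <= s n,
        forall n, r < unorm (f (x n) (j n)),
        forall n, C * s n.+1 < unorm (f (x n) (j n)) &
        forall k n, (k < n)%N -> unorm (f (x k) (j n)) <= r].
Proof.
move=> C0 rhoE g_inj escape r0.
(* [j0] is only a default value, at the stages that are not admissible. *)
have [_ [j0 _]] := escape (rho + 1) set0 set0 ltac:(by rewrite ltrDl)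
  (finite_set0 _) (finite_set0 _).
have gfin n : finite_set [set i | (g i < n)%N].
  by apply: (finite_preimage (B := `I_n)) => // i i' _ _; exact: g_inj.
(* A stage consists of its number, the current radius and the finite set of
   coordinates to be avoided. *)
pose admissible (p : nat * R * set J) := rho < p.1.2 /\ finite_set p.2.
pose hump (p : nat * R * set J) (q : bprod V * J) :=
  [/\ bprod_tail V [set i | (g i < p.1.1)%N] p.1.2 q.1, ~ p.2 q.2 &
      r < unorm (f q.1 q.2)].
have /choice[F FP] p : exists q, admissible p -> hump p q.
  have [[ps pJ]|] := pselect (admissible p); last by exists (0, j0).
  by have [x [j xj]] := escape _ _ _ ps (gfin p.1.1) pJ; exists (x, j).
pose radius s (q : bprod V * J) :=
  Num.min s ((rho + C^-1 * unorm (f q.1 q.2)) / 2).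
pose exceed (q : bprod V * J) := [set j | r < unorm (f q.1 j)].
pose next n (p : R * set J) :=
  (radius p.1 (F (n, p.1, p.2)), p.2 `|` exceed (F (n, p.1, p.2))).
pose fix stage n := if n is m.+1 then next m (stage m) else (rho + 1, set0).
pose q n := F (n, (stage n).1, (stage n).2).
have room y : r < y -> rho < C^-1 * y by rewrite rhoE ltr_pM2l ?invr_gt0.
have adm n : admissible (n, (stage n).1, (stage n).2).
  elim: n => [|n IHn]; first by split => /=; rewrite ?ltrDl//; exact: finite_set0.
  have [_ _ /room hr] := FP _ IHn; case: IHn => /= sn Jn; split => /=.
    by rewrite lt_min sn midf_lt.
  rewrite finite_setU; split=> //.
  by have /vanishingP/(_ r r0) := csumP (f (q n).1).
have hq n : hump (n, (stage n).1, (stage n).2) (q n) := FP _ (adm n).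
exists (fun n => (q n).1), (fun n => (q n).2), (fun n => (stage n).1).
split=> [n|n|n|n|k n kn].
- by have [] := hq n.
- by have [/= sn _] := adm n; split=> //=; rewrite ge_min lexx.
- by have [] := hq n.
- have [_ _ /room hr] := hq n.
  rewrite -ltr_pdivlMl//= gt_min; apply/orP; right.
  by rewrite (midf_lt hr).
- rewrite leNgt; apply/negP => kj; have [_ /= + _] := hq n; apply.
  have : (stage k.+1).2 `<=` (stage n).2.
    elim: n kn {kj} => // n IHn; rewrite ltnS leq_eqVlt => /orP[/eqP->//|/IHn].
    by move=> /subset_trans; apply => j; left.
  by apply; right.
Qed.

End gliding_hump.

Theorem theorem3p1 (R : realType) (I J : Type)
    (V : I -> banachZmodType R) (W : J -> banachZmodType R)
    (f : {additive bprod V -> csum W}) :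
  countable [set: I] ->
  bounded_hom f ->
  (exists x, f x != 0) ->
  forall r : R, 0 < r ->
  exists (r' : R) (I0 : set I) (J0 : set J),
    [/\ (opnorm f)^-1 * r < r', finite_set I0, finite_set J0 &
        f @` bprod_tail V I0 r' `<=` csum_tail W J0 r].
Proof.
move=> /countable_injP[g g_inj] f_bounded f_neq0 r r0.
have C0 := opnorm_gt0 f_bounded f_neq0.
apply: contrapT => no_tail.
have [] := @escaping_sequence _ _ _ _ _ f (opnorm f) r _ g C0 erefl _ _ r0.
- by move=> i i'; apply: g_inj; rewrite inE.
- move=> s I0 J0 s_gt I0fin J0fin; apply: contrapT => no_x; apply: no_tail.
  exists s, I0, J0; split=> // _ [x xI0 <-] j jJ0; rewrite leNgt.
  by apply/negP => fxj; apply: no_x; exists x, j.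
move=> x [j [s [x_tail s_rho xr xC early]]].
(* Not a consequence of [x_tail]: [I] may be empty. *)
have s_ge0 n : 0 <= s n.
  by apply: le_trans (ltW (s_rho n).1); rewrite mulr_ge0 ?invr_ge0 ?ltW.
have [|||S [Sx Ss]] := @locally_finite_sum _ _ _ g x s.
- by move=> k i; exact: (x_tail k).1.
- by move=> k; apply/bprod_norm_le => //; exact: (x_tail k).2.
- by move=> k; have [] := s_rho k.
exact: (gliding_hump (ltW C0) (opnorm_le f_bounded) r0 Sx Ss xr xC early).
Qed.
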